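(* Let $\bar M^{n+1}$ be the warped product $\mathbb R\times_\varrho N$, where $N$ is an $n$-dimensional Riemannian manifold and $\varrho:\mathbb R\to\mathbb R$ is a positive function. If the graph $\{(F(x),x):x\in N\}\subset\bar M$ of a function $F:N\to\mathbb R$ has a canonical principal direction relative to the vector field $\partial_t$ and the angle $\theta\in(0,\pi)$ between $\partial_t$ and the vector field $\xi$ normal to the graph is everywhere different from $\pi/2$, then $F$ is transnormal.
   Context: All objects are smooth. The warped product $\mathbb R\times_\varrho N$ is $\mathbb R\times N$ with the metric $dt^2+\varrho(t)^2 g_N$, where $g_N$ is the metric of $N$; $\partial_t$ is the lift to $\mathbb R\times_\varrho N$ of the standard unit vector field on $\mathbb R$. A differentiable function $F:N\to\mathbb R$ on a Riemannian manifold $N$ is transnormal if it satisfies $|\nabla F|=b\circ F$, where $b$ is a non-negative function. An orientable hypersurface $M$ of a Riemannian manifold has a canonical principal direction relative to a vector field $X$ if the projection $X^T$ of $X$ onto the tangent space of $M$ (assumed nowhere zero, equivalently the angle between $X$ and the normal field lies in $(0,\pi)$) gives a principal direction, i.e. $X^T$ is at each point an eigenvector of the shape operator of $M$. The normal field to the graph is $\xi=(\varrho\circ F)^2\partial_t-\nabla F$, where $\nabla F$ also denotes the lift to $\bar M$ of the gradient of $F$ on $N$, and the angle $\theta$ is given by $\cos\theta=\langle \xi/|\xi|,\partial_t\rangle$.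
   Formalization: Read globally, ''F is transnormal'' can fail: level sets of F may be disconnected, with |∇F| differing between components. Proved instead: F is transnormal near every point of N, and transnormal on all of N if every level set of F is connected. *)

(* Defs.v *)
From HB Require Import structures.
From mathcomp Require Import all_boot all_order all_algebra.
From mathcomp Require Import all_classical all_reals all_analysis.
Set Implicit Arguments. Unset Strict Implicit. Unset Printing Implicit Defensive.
Import Order.TTheory GRing.Theory Num.Theory.
Import numFieldNormedType.Exports.
Local Open Scope classical_set_scope.
Local Open Scope ring_scope.

(* C^infinity on an open set [U]: every iterated directional derivative is
   Frechet differentiable (hence continuous) at every point of [U]. *)
Definition smooth_on {R : realType} {V W : normedModType R}
    (U : set V) (f : V -> W) : Prop :=
  forall (vs : seq V) (x : V), U x ->
    differentiable (foldr (fun v g => 'D_v g) f vs) x.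

(* [chart_inv i] is only meaningful on the image of [chart_dom i]. *)
Record atlas (R : realType) (n : nat) := Atlas {
  space :> topologicalType;
  chart_idx : Type;
  chart_dom : chart_idx -> set space;
  chart : chart_idx -> space -> 'rV[R]_n;
  chart_inv : chart_idx -> 'rV[R]_n -> space }.

Section SmoothManifold.
Variables (R : realType) (n : nat) (M : atlas R n).

Definition chart_img (i : chart_idx M) : set 'rV[R]_n :=
  @chart _ _ M i @` chart_dom i.

Definition transition (i j : chart_idx M) (x : 'rV[R]_n) : 'rV[R]_n :=
  chart j (chart_inv i x).

Record is_smooth_manifold : Prop := {
  space_hausdorff : hausdorff_space M;
  space_second_countable : @second_countable M;
  chart_cover : forall p : M, exists i : chart_idx M, chart_dom i p;
  chart_dom_open : forall i : chart_idx M, open (chart_dom i);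
  chart_img_open : forall i : chart_idx M, open (chart_img i);
  chartK : forall (i : chart_idx M) (p : M),
    chart_dom i p -> chart_inv i (chart i p) = p;
  chart_continuous : forall (i : chart_idx M) (p : M),
    chart_dom i p -> {for p, continuous (@chart _ _ M i)};
  chart_inv_continuous : forall (i : chart_idx M) (x : 'rV[R]_n),
    chart_img i x -> {for x, continuous (@chart_inv _ _ M i)};
  transition_smooth : forall i j : chart_idx M,
    smooth_on (@chart _ _ M i @` (chart_dom i `&` chart_dom j))
              (transition i j) }.

Definition smooth_function (F : M -> R) : Prop :=
  forall i : chart_idx M,
    smooth_on (chart_img i) (fun x => F (chart_inv i x) : R^o).

End SmoothManifold.

Definition inner {R : realType} {n : nat} (G : 'M[R]_n) (u v : 'rV[R]_n) : R :=
  (u *m G *m v^T) 0 0.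

Definition vnorm {R : realType} {n : nat} (G : 'M[R]_n) (u : 'rV[R]_n) : R :=
  Num.sqrt (inner G u u).

(* [gram i x] is the Gram matrix of the coordinate fields of the chart [i] at
   the point with coordinates [x].  Tangent vectors at a point are given by
   their components (row vectors) in a chart; the objects defined below from
   such components are tensorial, and every condition on them is imposed in all
   charts around the point. *)
Record riemannian (R : realType) (n : nat) := Riemannian {
  atlas_of :> atlas R n;
  gram : chart_idx atlas_of -> 'rV[R]_n -> 'M[R]_n }.

Section Riemannian.
Variables (R : realType) (n : nat) (M : riemannian R n).

Definition gram_at (i : chart_idx M) (p : M) : 'M[R]_n := gram i (chart i p).

Record is_riemannian_manifold : Prop := {
  riemannian_smooth_manifold : is_smooth_manifold M;
  gram_smooth : forall (i : chart_idx M) (a b : 'I_n),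
    smooth_on (chart_img i) (fun x => gram i x a b : R^o);
  gram_sym : forall (i : chart_idx M) (p : M),
    chart_dom i p -> (gram_at i p)^T = gram_at i p;
  gram_posdef : forall (i : chart_idx M) (p : M) (v : 'rV[R]_n),
    chart_dom i p -> v != 0 -> 0 < inner (gram_at i p) v v;
  gram_transition : forall (i j : chart_idx M) (p : M) (u v : 'rV[R]_n),
    chart_dom i p -> chart_dom j p ->
    inner (gram_at i p) u v =
    inner (gram_at j p) ('D_u (transition i j) (chart i p))
                        ('D_v (transition i j) (chart i p)) }.

Definition grad (F : M -> R) (i : chart_idx M) (p : M) : 'rV[R]_n :=
  (\row_k 'D_(delta_mx 0 k) (fun x => F (chart_inv i x) : R^o) (chart i p))
    *m invmx (gram_at i p).

(* |grad F| = b o F on [U], with a single non-negative [b] for all of [U].  This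
   is stronger than |grad F| being locally constant along level sets when a
   level set of [F] in [U] is disconnected. *)
Definition transnormal_on (U : set M) (F : M -> R) : Prop :=
  exists b : R -> R, (forall s, 0 <= b s) /\
    forall (i : chart_idx M) (p : M), U p -> chart_dom i p ->
      vnorm (gram_at i p) (grad F i p) = b (F p).

Definition transnormal (F : M -> R) : Prop := transnormal_on setT F.

End Riemannian.

(* Levi-Civita connection of [G] on constant coordinate fields [u], [v]:
   Gamma^k_ij = 1/2 g^kl (d_i g_jl + d_j g_il - d_l g_ij), contracted. *)
Definition christoffel {R : realType} {m : nat} (G : 'rV[R]_m -> 'M[R]_m)
    (y u v : 'rV[R]_m) : 'rV[R]_m :=
  (\row_l (2^-1 *
     ('D_u (fun z => inner (G z) v (delta_mx 0 l) : R^o) y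
    + 'D_v (fun z => inner (G z) u (delta_mx 0 l) : R^o) y
    - 'D_(delta_mx 0 l) (fun z => inner (G z) u v : R^o) y)))
  *m invmx (G y).

(* Covariant derivative, in the direction [v] at [x], of the vector field [Y]
   along the map [c], for the Levi-Civita connection of [G]. *)
Definition cov_deriv {R : realType} {n m : nat} (G : 'rV[R]_m -> 'M[R]_m)
    (c Y : 'rV[R]_n -> 'rV[R]_m) (x v : 'rV[R]_n) : 'rV[R]_m :=
  'D_v Y x + christoffel G (c x) ('D_v c x) (Y x).

Section Hypersurface.
Variables (R : realType) (n : nat) (P : atlas R n) (M : riemannian R n.+1).

(* [f : P -> M] parametrizes the hypersurface; vector fields along [f] (such as
   the unit normal field [nu]) and vector fields on [M] are given by their
   components in each chart of [M]. *)
Variables (f : P -> M) (nu : chart_idx M -> P -> 'rV[R]_n.+1)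
          (X : chart_idx M -> M -> 'rV[R]_n.+1).

Definition local_map (i : chart_idx P) (j : chart_idx M) (x : 'rV[R]_n)
    : 'rV[R]_n.+1 := chart j (f (chart_inv i x)).

(* The tangent vector with components [v] in the chart [i] of [P] is the vector
   [pushforward i j p v] of M; its image by the shape operator is [shape i j p v]. *)
Definition pushforward (i : chart_idx P) (j : chart_idx M) (p : P)
    (v : 'rV[R]_n) : 'rV[R]_n.+1 := 'D_v (local_map i j) (chart i p).

Definition shape (i : chart_idx P) (j : chart_idx M) (p : P)
    (v : 'rV[R]_n) : 'rV[R]_n.+1 :=
  - cov_deriv (gram j) (local_map i j) (fun x => nu j (chart_inv i x))
              (chart i p) v.

Definition tangent_part (j : chart_idx M) (p : P) : 'rV[R]_n.+1 :=
  X j (f p) - inner (gram_at j (f p)) (X j (f p)) (nu j p) *: nu j p.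

Definition canonical_principal_direction : Prop :=
  forall (i : chart_idx P) (j : chart_idx M) (p : P),
    chart_dom i p -> chart_dom j (f p) ->
    tangent_part j p != 0 /\
    exists (v : 'rV[R]_n) (lambda : R),
      pushforward i j p v = tangent_part j p /\
      shape i j p v = lambda *: tangent_part j p.

End Hypersurface.

Section WarpedProduct.
Variables (R : realType) (n : nat) (N : riemannian R n) (rho : R -> R).

(* The chart of R x N induced by a chart x of N is (t, p) |-> (t, x(p)). *)
Definition warped_atlas : atlas R n.+1 := @Atlas R n.+1
  (R * N)%type (chart_idx N)
  (fun i => [set q | chart_dom i q.2])
  (fun i q => row_mx (q.1%:M : 'M[R]_1) (chart i q.2))
  (fun i y => (y 0 0, chart_inv i (rsubmx (y : 'rV[R]_(1 + n))))).

Definition warped_product : riemannian R n.+1 := @Riemannian R n.+1 warped_atlas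
  (fun i y => block_mx (1%:M : 'M[R]_1) 0 0
     (rho (y 0 0) ^+ 2 *: gram i (rsubmx (y : 'rV[R]_(1 + n))))).

Definition partial_t (i : chart_idx warped_product) (_ : warped_product)
    : 'rV[R]_n.+1 := row_mx (1%:M : 'M[R]_1) (0 : 'rV[R]_n).

Variable F : N -> R.

Definition graph (p : N) : warped_product := (F p, p).

Definition graph_normal (i : chart_idx warped_product) (p : N) : 'rV[R]_n.+1 :=
  row_mx ((rho (F p) ^+ 2)%:M : 'M[R]_1) (- grad F i p).

Definition graph_unit_normal (i : chart_idx warped_product) (p : N)
    : 'rV[R]_n.+1 :=
  (vnorm (gram_at i (graph p)) (graph_normal i p))^-1 *: graph_normal i p.

End WarpedProduct.

Arguments graph {R n N} rho F p.
Arguments graph_normal {R n N} rho F i p.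
Arguments graph_unit_normal {R n N} rho F i p.
Arguments partial_t {R n} N rho i _.

(* Main.v *)
Require Import Defs.
From HB Require Import structures.
From mathcomp Require Import all_boot all_order all_algebra.
From mathcomp Require Import all_classical all_reals all_analysis.
From mathcomp Require Import ring lra.
Set Implicit Arguments. Unset Strict Implicit. Unset Printing Implicit Defensive.
Import Order.TTheory GRing.Theory Num.Theory.
Import numFieldNormedType.Exports.
Local Open Scope classical_set_scope.
Local Open Scope ring_scope.

(** Write [f] for [F] read in a chart, [g] for the Gram matrix of [N] there,
    [w] for the gradient of [f] and [h = g(w, w)] for its squared length.  The
    unit normal of the graph is [phi (rho^2, - w)] with [phi > 0], so the
    tangential part of the field d/dt is the push-forward of [v = k w], where
    [k = phi^2 rho^2 > 0].  It vanishes as soon as [w] does; hence a canonical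
    principal direction forces the gradient of [F] to be nowhere zero.

    Let [u] be tangent to a level set of [f], that is, [df(u) = 0].  The
    push-forward of [u] is [(0, u)]; it is orthogonal to the push-forward of [w]
    and to the normal.  If [v] is principal, the covariant derivative of the
    unit normal along [v] is therefore orthogonal to [(0, u)].  Expanding
    this with the Christoffel symbols of the warped metric, every term that
    involves a derivative of [rho] or of [phi] is multiplied by [df(u)], by
    [g(w, u)] or by the zero first component of [(0, u)].  What remains
    ([inner_cov_deriv_normal]) is the equation
      [D_w D_u f = (D_u g)(w, w) / 2],
    in which [w] is frozen at the point as a constant coordinate direction.
    On the other hand, differentiating [g(w, .) = df] gives
    [D_u h = 2 D_u D_w f - (D_u g)(w, w)] ([derive_sqgrad]), so by the symmetry
    of second derivatives ([schwarz]) [D_u h = 0] ([principal_direction_local]).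

    So [dh] vanishes on every vector on which [df] does, and [df] is nowhere
    zero.  Two nearby points of one level set are joined by a curve in this level
    set: follow the segment between them, correcting each of its points along a
    direction in which [f] is strictly increasing.  The function [h] is stationary along this
    curve, hence takes equal values at its ends ([constant_on_level_sets]).  This
    is local transnormality.  The length of the gradient does not depend
    on the chart ([vnorm_grad_chart]), so it is a locally constant function on
    each level set, and a constant one when the level set is connected
    ([locally_transnormal_connected]). *)

(** * The mean value theorem on lines and the symmetry of second derivatives *)

Section Lines.
Context {R : realType} {V : normedModType R}.
Implicit Types (f : V -> R^o) (x v : V).

Lemma is_derive_line f x v (t : R) : derivable f (x + t *: v) v ->
  is_derive t (1 : R) (fun s : R => f (x + s *: v)) ('D_v f (x + t *: v)).
Proof.
have E : (fun h : R => h^-1 *: (((fun s : R => f (x + s *: v)) \o shift t)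
            (h *: (1 : R)) - f (x + t *: v))) =
         (fun h : R => h^-1 *: ((f \o shift (x + t *: v)) (h *: v)
            - f (x + t *: v))).
  apply/funext => h /=.
  by rewrite [h *: 1]mulr1 scalerDl addrCA.
by move=> df; split; rewrite /derivable /derive E.
Qed.

Lemma mvt_line f x v (a b : R) : a <= b ->
  (forall t, a <= t <= b -> differentiable f (x + t *: v)) ->
  exists2 t, a <= t <= b &
    f (x + b *: v) - f (x + a *: v) = 'D_v f (x + t *: v) * (b - a).
Proof.
move=> ab df.
have dl t : a <= t <= b -> is_derive t (1 : R) (fun s : R => f (x + s *: v))
    ('D_v f (x + t *: v)).
  by move=> /df ?; apply/is_derive_line/diff_derivable.
have [|||t tab E] := @MVT_segment R (fun s => f (x + s *: v))
  (fun t => 'D_v f (x + t *: v)) a b => //.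
- move=> t; rewrite in_itv/= => /andP[a1 a2]; apply: dl.
  by rewrite !ltW.
- apply: derivable_within_continuous => t; rewrite in_itv/= => tab.
  by have [] := dl t tab.
- by exists t => //; move: tab; rewrite in_itv.
Qed.

End Lines.

Section Schwarz.
Context {R : realType} {V : normedModType R}.
Implicit Types (f : V -> R^o) (x u v : V).

(** Applying the mean value theorem to [t |-> f (x + s v + t u) - f (x + t u)],
    and then along [v] to the derivative of [f] in the direction [u], turns the
    second difference into a mixed derivative at some point of the
    parallelogram. *)
Lemma second_difference f x u v (s : R) (B : set V) : 0 <= s ->
  (forall t t' : R, 0 <= t <= s -> 0 <= t' <= s ->
     B (x + t *: u + t' *: v)) ->
  (forall y, B y -> differentiable f y /\ differentiable ('D_u f) y) ->
  exists2 y, B y &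
    f (x + s *: u + s *: v) - f (x + s *: u) - f (x + s *: v) + f x =
    'D_v ('D_u f) y * s * s.
Proof.
move=> s0 Bx dB.
pose phi (t : R) := f (x + s *: v + t *: u) - f (x + t *: u).
have swap t t' : x + t *: v + t' *: u = x + t' *: u + t *: v by rewrite addrAC.
have dphi t : 0 <= t <= s -> is_derive t (1 : R) (phi : R -> R^o)
    ('D_u f (x + s *: v + t *: u) - 'D_u f (x + t *: u)).
  move=> ts; apply: is_deriveB; apply/is_derive_line/diff_derivable.
    by rewrite swap; apply: (dB _ _).1; apply: Bx => //; rewrite s0 lexx.
  have := Bx t 0 ts; rewrite lexx s0 scale0r addr0 => /(_ isT) /dB; tauto.
have [|||t] := @MVT_segment R phi
   (fun t => 'D_u f (x + s *: v + t *: u) - 'D_u f (x + t *: u)) 0 s => //.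
- by move=> t; rewrite in_itv/= => /andP[a1 a2]; apply: dphi; rewrite !ltW.
- apply: derivable_within_continuous => t; rewrite in_itv/= => tab.
  by have [] := dphi t tab.
rewrite in_itv/= subr0 => ts Ephi.
have [|t' t's E] := @mvt_line R V ('D_u f) (x + t *: u) v 0 s s0.
  by move=> t' ?; apply: (dB _ _).2; exact: Bx.
exists (x + t *: u + t' *: v); first exact: Bx.
move: E; rewrite scale0r addr0 subr0 => <-.
rewrite [x + t *: u + s *: v]addrAC -Ephi /phi scale0r !addr0 swap.
by ring.
Qed.

Lemma mulrr_injr (s a b : R) : 0 < s -> a * s * s = b * s * s -> a = b.
Proof.
by move=> s0; have s1 : s != 0 by [rewrite gt_eqF]; do 2!move/(mulIf s1).
Qed.

Lemma ler_dist_half2 (e a b c : R) :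
  `|a - c| < e / 2 -> `|b - c| < e / 2 -> `|a - b| <= e.
Proof.
move=> ac bc; rewrite -(subrK c a) -addrA [e]splitr.
by rewrite (le_trans (ler_normD _ _))// lerD // ltW // distrC.
Qed.

(** The second difference is symmetric in [u] and [v], so for small [s] both mixed
    derivatives take a common value, each at a point close to [x]; continuity at
    [x] concludes. *)
Lemma schwarz f x u v :
  (\forall y \near x, [/\ differentiable f y, differentiable ('D_u f) y
                       & differentiable ('D_v f) y]) ->
  {for x, continuous ('D_u ('D_v f))} -> {for x, continuous ('D_v ('D_u f))} ->
  'D_u ('D_v f) x = 'D_v ('D_u f) x.
Proof.
move=> df cuv cvu; apply/eqP; rewrite -subr_eq0 -normr_le0.
apply/ler_addgt0Pr => e e0; rewrite add0r.
have e2 : 0 < e / 2 by rewrite divr_gt0.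
have [d /= d0 dB] := (nbhs_ballP _ _).1
  (filterI df (filterI ((cvgrPdist_lt _ _).1 cuv _ e2)
                       ((cvgrPdist_lt _ _).1 cvu _ e2))).
(* the factor [K] makes the parallelogram with sides [s u] and [s v] fit in the
   ball of radius [d] *)
pose K := `|u| + `|v| + 1.
have K0 : 0 < K by rewrite ltr_wpDl // addr_ge0.
pose s := d / 2 / K.
have s0 : 0 < s by rewrite !divr_gt0.
have Bx a b : `|a| + `|b| + 1 = K -> forall t t' : R, 0 <= t <= s ->
    0 <= t' <= s -> ball x d (x + t *: a + t' *: b).
  move=> abK t t' /andP[t0 ts] /andP[t'0 t's].
  rewrite -ball_normE /= -addrA opprD addrA subrr add0r normrN.
  apply: le_lt_trans (ler_normD _ _) _; rewrite !normrZ !ger0_norm//.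
  apply: (@le_lt_trans _ _ (s * K)).
    rewrite -abK !mulrDr mulr1 -[leLHS]addr0.
    by rewrite !lerD // ?ler_wpM2r // ltW.
  by rewrite /s divfK ?gt_eqF // ltr_pdivrMr // ltr_pMr // ltr1n.
have [|y yB E] := @second_difference f x u v s _ (ltW s0) (Bx u v erefl).
  by move=> y /dB[[? ? ?] _].
have vuK : `|v| + `|u| + 1 = K by rewrite /K (addrC `|v|).
have [|z zB E'] := @second_difference f x v u s _ (ltW s0) (Bx v u vuK).
  by move=> z /dB[[? ? ?] _].
have EE : 'D_v ('D_u f) y = 'D_u ('D_v f) z.
  have sym : f (x + s *: u + s *: v) - f (x + s *: u) - f (x + s *: v) + f x =
             f (x + s *: v + s *: u) - f (x + s *: v) - f (x + s *: u) + f x :> R.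
    by rewrite [x + s *: v + _]addrAC; congr (_ + _); rewrite [LHS]addrAC.
  exact: (mulrr_injr s0) (etrans (esym E) (etrans sym E')).
have [_ [+ _]] := dB z zB; have [_ [_ +]] := dB y yB.
rewrite EE; move: ('D_u ('D_v f) x) ('D_v ('D_u f) x) ('D_u ('D_v f) z) => a b c.
by move=> h1 h2; exact: ler_dist_half2 h2 h1.
Qed.

End Schwarz.

(** * Functions stationary along level sets *)

Section FirstOrder.
Context {R : realType} {V : normedModType R}.
Implicit Types (f k : V -> R^o) (x v : V).

Lemma diff_approx k x : differentiable k x -> forall e : R, 0 < e ->
  \forall y \near x, `|k y - k x - 'D_(y - x) k x| <= e * `|y - x|.
Proof.
move=> dk e e0; have := diff_locally dk => /eqaddoP /(_ e e0) => H; rewrite (near_shift 0) /=; apply: filterS H => y /=.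
by rewrite subr0 addrK deriveE // opprD addrA.
Qed.

Lemma is_derive_small (H : R -> R^o) (s : R) :
  (forall e : R, 0 < e -> \forall t \near s, `|H t - H s| <= e * `|t - s|) ->
  is_derive s (1 : R) H 0.
Proof.
move=> small.
have L : (fun h : R => h^-1 *: ((H \o shift s) (h *: (1 : R)) - H s)) @ 0^'
    --> (0 : R^o).
  apply/cvgr0Pnorm_le => e e0; rewrite near_withinE.
  have := small e e0; rewrite (near_shift 0) /= => S; apply: filterS S => h /=.
  rewrite subr0 addrK => hs h0.
  rewrite [h *: 1]mulr1 normrZ normfV ler_pdivrMl ?normr_gt0 //.
  by rewrite mulrC.
by split; [apply/cvg_ex; exists (0 : R^o) | exact: cvg_lim].
Qed.

End FirstOrder.

Lemma derive_dirBZ {R : realType} {V : normedModType R} (k : V -> R^o)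
    (y u v : V) (a : R) : differentiable k y ->
  'D_(u - a *: v) k y = 'D_u k y - a * 'D_v k y.
Proof.
move=> dk.
by rewrite (deriveE (u - a *: v) dk) (deriveE u dk) (deriveE v dk) linearB linearZ.
Qed.

Lemma eq_ratio_mul {R : realType} (a b c d : R) : a != 0 ->
  (b - b / a * a = 0 -> d - b / a * c = 0) -> d = c / a * b.
Proof.
move=> a0; rewrite divfK // subrr => /(_ erefl)/eqP.
by rewrite subr_eq0 => /eqP ->; field.
Qed.

Lemma derive_dirZ {R : realType} {V : normedModType R} (k : V -> R^o)
    (y v : V) (a : R) : differentiable k y ->
  'D_(a *: v) k y = a * 'D_v k y.
Proof.
by move=> dk; rewrite (deriveE (a *: v) dk) (deriveE v dk) linearZ.
Qed.

Lemma normr_le_near_linear {R : realType} (x a b n : R) :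
  `|x - a * b| <= 1 * (`|a| * n) -> `|x| <= (`|b| + n) * `|a|.
Proof.
rewrite mul1r => xab; rewrite -[x](subrK (a * b)).
rewrite (le_trans (ler_normD _ _))// normrM mulrDl addrC.
by rewrite [n * _]mulrC [`|b| * _]mulrC lerD.
Qed.

(** [f] grows at rate at least [m] in the direction [e] throughout [B]; this
    replaces the implicit function theorem for the level sets of [f]. *)
Section LevelSets.
Context {R : realType} {V : normedModType R}.
Variables (f h : V -> R^o) (e : V) (B : set V) (m : R).
Hypotheses (m0 : 0 < m)
  (df : forall y, B y -> differentiable f y)
  (dh : forall y, B y -> differentiable h y)
  (De : forall y, B y -> m <= 'D_e f y)
  (dfh : forall y u, B y -> 'D_u f y = 0 -> 'D_u h y = 0).

Lemma growth_along (y : V) (a b : R) : a <= b ->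
  (forall t, a <= t <= b -> B (y + t *: e)) ->
  m * (b - a) <= f (y + b *: e) - f (y + a *: e).
Proof.
move=> ab yB.
have [|t tab ->] := @mvt_line R V f y e a b ab.
  by move=> t /yB; exact: df.
by rewrite ler_wpM2r ?subr_ge0 //; apply/De/yB.
Qed.

Lemma dist_along (y : V) (tau a b : R) :
  (forall t, `|t| <= tau -> B (y + t *: e)) -> `|a| <= tau -> `|b| <= tau ->
  m * `|b - a| <= `|f (y + b *: e) - f (y + a *: e)|.
Proof.
move=> yB; wlog ab : a b / a <= b => [wl|] at' bt.
  have [ab|ba] := leP a b; first exact: wl.
  by rewrite distrC [leRHS]distrC; apply: wl => //; exact: ltW.
rewrite ger0_norm ?subr_ge0 //; apply: le_trans (ler_norm _).
apply: growth_along => // t /andP[a1 a2]; apply: yB.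
move: at' bt; rewrite !ler_norml => /andP[b1 b2] /andP[b3 b4].
by rewrite (le_trans b1 a1) (le_trans a2 b4).
Qed.

(** Subtracting from [u] its component along [e] gives a vector in the kernel of
    the differential of [f], hence of that of [h]. *)
Lemma derive_proportional (y : V) : B y ->
  exists mu : R, forall u, 'D_u h y = mu * 'D_u f y.
Proof.
move=> yB; have D0 : 'D_e f y != 0 by rewrite gt_eqF // (lt_le_trans m0) ?De.
exists ('D_e h y / 'D_e f y) => u.
have := dfh (u := u - ('D_u f y / 'D_e f y) *: e) yB.
have [dfy dhy] := (df yB, dh yB).
rewrite (derive_dirBZ _ _ _ dfy) (derive_dirBZ _ _ _ dhy).
exact: eq_ratio_mul.
Qed.

(** The correction [T] will come from the intermediate value theorem, so its
    regularity has to be extracted from the level equation.  Since [f] grows along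
    [e], [T] is Lipschitz at [s], and then first-order expansions at the point [P]
    of the curve suffice: with [dh = mu df] at [P], the function [h - mu f] has zero
    differential there, and along the curve it differs from [h] by a
    constant. *)
Lemma level_curve_stationary (p d : V) (T : R -> R) (tau c s : R) :
  (\forall t \near s, [/\ `|T t| <= tau, f (p + t *: d + T t *: e) = c &
     forall a, `|a| <= tau -> B (p + t *: d + a *: e)]) ->
  is_derive s (1 : R) (fun t : R => h (p + t *: d + T t *: e)) 0.
Proof.
move=> nT; have [Ts fs Bs] := nbhs_singleton nT.
pose P := p + s *: d + T s *: e.
have BP : B P by exact: Bs.
have [mu Dmu] := derive_proportional BP.
(* [C] bounds the slope of [f] along [d], [C / m] that of [T], and [K] that of
   the curve *)
pose C : R := `|'D_d f P| + `|d|.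
have C0 : 0 <= C by rewrite addr_ge0.
pose K : R := `|d| + C / m * `|e| + 1.
have K0 : 0 < K by rewrite ltr_wpDl // addr_ge0 // mulr_ge0 // divr_ge0 // ltW.
have shiftE t : p + t *: d + T s *: e = P + (t - s) *: d.
  by rewrite /P scalerBl [p + s *: d + _]addrAC -[RHS]addrA
     [s *: d + _]addrC subrK addrAC.
have lipf : \forall t \near s, `|f (P + (t - s) *: d) - f P| <= C * `|t - s|.
  have lin : (fun t : R => P + (t - s) *: d) @ s --> P.
    rewrite -[X in _ --> X]addr0 -(scale0r d) -(subrr s).
    apply: cvgD; first exact: cvg_cst.
    apply: cvgZr_tmp; apply: cvgB; [exact: cvg_id|exact: cvg_cst].
  have L : \forall t \near s,
      `|f (P + (t - s) *: d) - f P - 'D_(P + (t - s) *: d - P) f P|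
      <= 1 * `|P + (t - s) *: d - P|.
    exact: (lin _ (diff_approx (df BP) ltr01)).
  apply: filterS L => t.
  have -> : P + (t - s) *: d - P = (t - s) *: d by rewrite addrC addKr.
  rewrite (derive_dirZ _ _ (df BP)) normrZ.
  exact: normr_le_near_linear.
have lipT : \forall t \near s, `|T t - T s| <= C / m * `|t - s|.
  near=> t.
  have [Tt ft Bt] : [/\ `|T t| <= tau, f (p + t *: d + T t *: e) = c &
     forall a, `|a| <= tau -> B (p + t *: d + a *: e)] by near: t.
  rewrite mulrAC ler_pdivlMr // mulrC.
  apply: le_trans (dist_along Bt Ts Tt) _.
  rewrite ft (shiftE t) -fs distrC.
  by near: t.
apply: is_derive_small => eps eps0.
pose k : V -> R^o := h - mu *: f.
have dk : differentiable k P.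
  by apply: differentiableB; [exact: dh|apply: differentiableZ; exact: df].
have Dk u : 'D_u k P = 0.
  rewrite /k deriveB; [|exact/diff_derivable/dh|exact/derivableZ/diff_derivable/df].
  by rewrite deriveZ ?Dmu ?subrr //; exact/diff_derivable/df.
have eK : 0 < eps / K by rewrite divr_gt0.
have [eta /= eta0 ketaP] := (nbhs_ballP _ _).1 (diff_approx dk eK).
have near_s : \forall t \near s, `|t - s| < K^-1 * eta.
  apply/nbhs_ballP; exists (K^-1 * eta) => [|t] /=.
    by rewrite mulr_gt0 // invr_gt0.
  by rewrite -ball_normE /= distrC.
near=> t.
have [Tt ft Bt] : [/\ `|T t| <= tau, f (p + t *: d + T t *: e) = c &
   forall a, `|a| <= tau -> B (p + t *: d + a *: e)] by near: t.
pose Q := p + t *: d + T t *: e.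
have QP : `|Q - P| <= K * `|t - s|.
  have -> : Q - P = (t - s) *: d + (T t - T s) *: e.
    rewrite /Q /P !scalerBl -[p + _ + _]addrA -[p + s *: d + _]addrA.
    by rewrite opprD addrACA subrr add0r opprD addrACA.
  apply: le_trans (ler_normD _ _) _; rewrite !normrZ /K -addrA mulrDl.
  rewrite lerD //; first by rewrite mulrC.
  rewrite mulrDl mul1r -[leLHS]addr0 lerD // mulrAC ler_wpM2r //.
  by near: t.
have /ketaP : ball P eta Q.
  rewrite -ball_normE /= distrC (le_lt_trans QP) // -ltr_pdivlMl //.
  by near: t.
rewrite Dk subr0 /k -![(_ - _ : V -> R^o) _]/(_ - _).
rewrite -![(_ *: _ : V -> R^o) _]/(_ *: _) ft fs.
rewrite [X in `|X|](_ : _ = h Q - h P); last by rewrite opprD addrACA subrr addr0.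
move=> /le_trans; apply; rewrite -mulrA ler_pM2l // ler_pdivrMl //.
Unshelve. all: by end_near. Qed.

Lemma level_meets_segment (y : V) (tau c : R) : 0 <= tau ->
  (forall a, `|a| <= tau -> B (y + a *: e)) -> `|f y - c| <= m * tau ->
  exists2 a, `|a| <= tau & f (y + a *: e) = c.
Proof.
move=> tau0 By; rewrite ler_distlC => /andP[yc1 yc2].
have y0 : y = y + 0 *: e by rewrite scale0r addr0.
have Bt t : - tau <= t <= tau -> B (y + t *: e).
  by move=> ?; apply: By; rewrite ler_norml.
have up : f y + m * tau <= f (y + tau *: e).
  rewrite -lerBrDl -{1}(subr0 tau) {2}y0.
  apply: growth_along => // t /andP[t1 t2]; apply: Bt.
  by rewrite t2 (le_trans _ t1) // oppr_le0.
have dn : f (y + (- tau) *: e) <= f y - m * tau.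
  rewrite lerBrDr -lerBrDl.
  have -> : m * tau = m * (0 - - tau) by rewrite opprK add0r.
  rewrite {1}y0; apply: growth_along; first by rewrite oppr_le0.
  by move=> t /andP[t1 t2]; apply: Bt; rewrite t1 (le_trans t2).
have [|||a] := @IVT R (fun t => f (y + t *: e)) (- tau) tau c.
- by rewrite ge0_cp.
- apply: derivable_within_continuous => t; rewrite in_itv/= => /Bt yt.
  by have [] := is_derive_line (@diff_derivable _ _ _ _ _ e (df yt)).
- rewrite ge_min le_max; apply/andP; split; apply/orP.
    by left; rewrite (le_trans dn) // lerBlDr.
  by right; rewrite (le_trans _ up) // -lerBlDr.
- by rewrite in_itv /= => atau fa; exists a => //; rewrite ler_norml.
Qed.

(** The values [T 0] and [T 1] of the correction vanish because [f] is injective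
    along [e], so the level curve joins [p] to [q]. *)
Lemma eq_along_level (p q : V) (tau : R) : 0 < tau ->
  (forall s : R, 0 <= s <= 1 -> \forall t \near s,
     (forall a, `|a| <= tau -> B (p + t *: (q - p) + a *: e)) /\
     `|f (p + t *: (q - p)) - f p| <= m * tau) ->
  f p = f q -> h p = h q.
Proof.
move=> tau0 seg fpq.
have /choice[T HT] : forall t : R, exists a : R,
    (forall a, `|a| <= tau -> B (p + t *: (q - p) + a *: e)) /\
     `|f (p + t *: (q - p)) - f p| <= m * tau ->
     `|a| <= tau /\ f (p + t *: (q - p) + a *: e) = f p.
  move=> t; have [G|NG] := pselect ((forall a, `|a| <= tau ->
     B (p + t *: (q - p) + a *: e)) /\ `|f (p + t *: (q - p)) - f p| <= m * tau).
    have [a aT fa] := level_meets_segment (ltW tau0) G.1 G.2.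
    by exists a.
  by exists 0 => G; case: NG.
have T_end (t : R) : 0 <= t <= 1 -> f (p + t *: (q - p)) = f p -> T t = 0.
  move=> t01 ft; have G := nbhs_singleton (seg t t01).
  have [Tt fT] := HT t G.
  have := dist_along G.1 (a := 0) (b := T t) _ Tt.
  rewrite normr0 scale0r addr0 fT ft subrr normr0 subr0 => /(_ (ltW tau0)).
  by rewrite pmulr_rle0 // normr_le0 => /eqP.
pose H (t : R) : R^o := h (p + t *: (q - p) + T t *: e).
have dH (s : R) : 0 <= s <= 1 -> is_derive s (1 : R) H 0.
  move=> s01; apply: (@level_curve_stationary p (q - p) T tau (f p)).
  by apply: filterS (seg s s01) => t G; have [Tt fT] := HT t G; split => //; case: G.
have [|||x _] := @MVT_segment R H (fun=> 0) 0 1 => //.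
- by move=> x; rewrite in_itv/= => /andP[x0 x1]; apply: dH; rewrite !ltW.
- apply: derivable_within_continuous => t; rewrite in_itv/= => tab.
  by have [] := dH t tab.
have T0 : T 0 = 0 by apply: T_end; rewrite ?lexx ?ler01 // scale0r addr0.
have T1 : T 1 = 0.
  by apply: T_end; rewrite ?lexx ?ler01 // scale1r addrC subrK.
rewrite mul0r /H T0 T1 !scale0r !addr0 scale1r [p + _]addrC subrK => /eqP.
by rewrite subr_eq0 => /eqP.
Qed.

End LevelSets.

Lemma convex_lt {R : realType} (s a b d : R) : 0 <= s -> s <= 1 ->
  a < d -> b < d -> (1 - s) * a + s * b < d.
Proof.
move=> s0 s1 ad bd.
have [->|sn0] := eqVneq s 0; first by rewrite subr0 mul0r mul1r addr0.
have sgt0 : 0 < s by rewrite lt_neqAle eq_sym sn0.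
have -> : d = (1 - s) * d + s * d by ring.
by rewrite ler_ltD // ?ltr_pM2l // ler_wpM2l ?subr_ge0 // ltW.
Qed.

Lemma half_le {R : realType} (a b : R) : `|a - b| < a / 2 -> a / 2 <= b.
Proof. rewrite ltr_distlC => /andP[? _]; lra. Qed.

(** Here [tau] bounds the correction along [e], and [d] is so small that [f]
    varies by less than [m * tau] on the ball of radius [d]: this lets the
    correction reach the wanted level from every point of the segment, while
    staying in the ball on which the hypotheses hold. *)
Lemma constant_on_level_sets {R : realType} {V : normedModType R}
    (f h : V -> R^o) (e x : V) :
  (\forall y \near x, [/\ differentiable f y, differentiable h y &
     forall u, 'D_u f y = 0 -> 'D_u h y = 0]) ->
  0 < 'D_e f x -> {for x, continuous ('D_e f)} ->
  exists2 d : R, 0 < d & forall p q, ball x d p -> ball x d q ->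
    f p = f q -> h p = h q.
Proof.
move=> nfh De0 cDe; pose m : R := 'D_e f x / 2.
have m0 : 0 < m by rewrite divr_gt0.
have nDe : \forall y \near x, m <= 'D_e f y.
  have C : \forall y \near x, `|'D_e f x - 'D_e f y| < m.
    exact: ((cvgrPdist_lt _ _).1 cDe m m0).
  by apply: filterS C => y; exact: half_le.
have [r /= r0 rB] := (nbhs_ballP _ _).1 (filterI nfh nDe).
pose tau := r / 2 / (`|e| + 1).
have e1 : 0 < `|e| + 1 by rewrite ltr_wpDl.
have tau0 : 0 < tau by rewrite !divr_gt0.
have mtau : 0 < m * tau / 2 by rewrite divr_gt0 // mulr_gt0.
have cf : {for x, continuous f}.
  by apply: differentiable_continuous; have [] := nbhs_singleton nfh.
have [d1 /= d10 d1B] := (nbhs_ballP _ _).1 ((cvgrPdist_lt _ _).1 cf _ mtau).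
pose d := Num.min d1 (r / 2).
have d0 : 0 < d by rewrite lt_min d10 divr_gt0.
exists d => // p q xp xq.
have dist_f y z : ball x d y -> ball x d z -> `|f z - f y| <= m * tau.
  move=> xy xz; rewrite -(subrK (f x) (f z)) -addrA (splitr (m * tau)).
  rewrite (le_trans (ler_normD _ _)) // lerD // ltW // ?[`|f z - _|]distrC.
    by apply: d1B; apply: le_ball xz; rewrite ge_min lexx.
  by apply: d1B; apply: le_ball xy; rewrite ge_min lexx.
apply: (@eq_along_level _ _ f h e (ball x r) m m0) tau0 _.
- by move=> y /rB[[]].
- by move=> y /rB[[]].
- by move=> y /rB[].
- by move=> y u /rB[[_ _ +] _]; apply.
move=> s s01.
have nseg : \forall t \near s, ball x d (p + t *: (q - p)).
  have xs : ball x d (p + s *: (q - p)).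
    move: xp xq; rewrite -!ball_normE /= => xp xq.
    have -> : x - (p + s *: (q - p)) = (1 - s) *: (x - p) + s *: (x - q).
      rewrite !scalerBr scalerBl !scale1r scalerBl scale1r.
      by rewrite [x - s *: x - _]addrAC subrKA addrCA opprD addrA addrAC.
    have /andP[s0 s1] := s01.
    rewrite (le_lt_trans (ler_normD _ _)) // !normrZ !ger0_norm ?subr_ge0 //.
    exact: convex_lt.
  have ct : (fun t : R => p + t *: (q - p)) @ s --> p + s *: (q - p).
    by apply: cvgD; [exact: cvg_cst|apply: cvgZr_tmp; exact: cvg_id].
  by apply: ct; apply: open_nbhs_nbhs; split; [exact: ball_open|exact: xs].
apply: filterS nseg => t xt; split; last exact: dist_f.
move=> a atau; move: xt; rewrite -!ball_normE /= => xt.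
rewrite opprD addrA (le_lt_trans (ler_normD _ _)) // normrN normrZ.
rewrite [r]splitr ltr_leD //.
  by rewrite (lt_le_trans xt) // ge_min lexx orbT.
rewrite (le_trans (ler_wpM2r _ atau)) // /tau mulrAC ler_pdivrMr //.
by rewrite ler_pM2l ?divr_gt0 // lerDl.
Qed.

(** * Differentiability of matrix operations *)

Section Differentiability.
Context {R : realType} {V : normedModType R}.

Lemma near_eq_differentiable {W : normedModType R} (f g : V -> W) (x : V) :
  (\forall y \near x, f y = g y) -> differentiable f x -> differentiable g x.
Proof.
move=> fg df.
have E : g \o shift x = cst (g x) + 'd f x +o_ 0 id.
  apply/eqaddoP => e e0.
  have := diff_locally df => /eqaddoP /(_ e e0).
  rewrite -(nbhs_singleton fg).
  move: fg; rewrite (near_shift 0) /= => fg.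
  apply: filterS2 fg => y /=; rewrite subr0 => fgy.
  by rewrite !fctE /= -fgy.
have dg : 'd g x = 'd f x :> (V -> W).
  by apply: diff_unique => //; exact: diff_continuous.
by apply/diff_locallyP; rewrite dg; split => //; exact: diff_continuous.
Qed.

Lemma differentiable_bigsum (I : Type) (r : seq I) (P : pred I)
    (F : I -> V -> R^o) (x : V) : (forall i, differentiable (F i) x) ->
  differentiable (fun y => \sum_(i <- r | P i) F i y : R^o) x.
Proof.
move=> dF; elim: r => [|i r IH].
  by under eq_fun do rewrite big_nil; exact: differentiable_cst.
under eq_fun do rewrite big_cons; case: (P i) => //.
exact: (differentiableD (dF i) IH).
Qed.

Lemma differentiable_bigprod (I : Type) (r : seq I) (P : pred I)
    (F : I -> V -> R^o) (x : V) : (forall i, differentiable (F i) x) ->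
  differentiable (fun y => \prod_(i <- r | P i) F i y : R^o) x.
Proof.
move=> dF; elim: r => [|i r IH].
  by under eq_fun do rewrite big_nil; exact: differentiable_cst.
under eq_fun do rewrite big_cons; case: (P i) => //.
exact: (differentiableM (dF i) IH).
Qed.

Lemma differentiable_mulc (f : V -> R^o) (c : R) (x : V) :
  differentiable f x -> differentiable (fun y => c * f y : R^o) x.
Proof. exact: (@differentiableZ _ _ _ f c). Qed.

Lemma differentiable_det (n : nat) (A : V -> 'M[R]_n) (x : V) :
  (forall i j, differentiable (fun y => A y i j : R^o) x) ->
  differentiable (fun y => \det (A y) : R^o) x.
Proof.
move=> dA; rewrite /determinant; apply: differentiable_bigsum => s.
apply: differentiable_mulc.
by apply: differentiable_bigprod => i.
Qed.

(** By Cramer's rule the entries are, near [x], polynomials in the entries of [A]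
    divided by its determinant. *)
Lemma differentiable_invmx (n : nat) (A : V -> 'M[R]_n) (x : V) :
  (forall i j, differentiable (fun y => A y i j : R^o) x) ->
  (\forall y \near x, A y \in unitmx) ->
  forall i j, differentiable (fun y => invmx (A y) i j : R^o) x.
Proof.
move=> dA uA i j.
apply: (@near_eq_differentiable _ (fun y => (\det (A y))^-1 * \adj (A y) i j : R^o)).
  by apply: filterS uA => y uy; rewrite /invmx uy !mxE.
apply: (differentiableM (f := fun y => (\det (A y))^-1)).
  apply: differentiableV; first exact: differentiable_det.
  by have := nbhs_singleton uA; rewrite unitmxE unitfE.
under eq_fun do rewrite mxE.
apply: differentiable_mulc.
by apply: differentiable_det => k l; under eq_fun do rewrite !mxE.
Qed.

End Differentiability.

(** * Metrics in coordinates *)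

Section Inner.
Context {R : realType} {n : nat}.
Implicit Types (G : 'M[R]_n) (u v : 'rV[R]_n).

Lemma innerDl G u u' v : inner G (u + u') v = inner G u v + inner G u' v.
Proof. by rewrite /inner !mulmxDl mxE. Qed.

Lemma innerZl G a u v : inner G (a *: u) v = a * inner G u v.
Proof. by rewrite /inner -!scalemxAl mxE. Qed.

Lemma innerDr G u v v' : inner G u (v + v') = inner G u v + inner G u v'.
Proof. by rewrite /inner linearD /= mulmxDr mxE. Qed.

Lemma innerZr G a u v : inner G u (a *: v) = a * inner G u v.
Proof. by rewrite /inner linearZ /= -scalemxAr mxE. Qed.

Lemma innerNl G u v : inner G (- u) v = - inner G u v.
Proof. by rewrite -scaleN1r innerZl mulN1r. Qed.

Lemma innerNr G u v : inner G u (- v) = - inner G u v.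
Proof. by rewrite -scaleN1r innerZr mulN1r. Qed.

Lemma innerC G u v : G^T = G -> inner G u v = inner G v u.
Proof.
move=> sG; rewrite /inner -[in LHS](trmxK (u *m G *m v^T)) mxE.
by rewrite !trmx_mul trmxK sG mulmxA.
Qed.

Lemma innerE G u v : inner G u v = \sum_k \sum_l u 0 k * G k l * v 0 l.
Proof.
rewrite /inner mxE exchange_big /=; apply: eq_bigr => l _.
by rewrite !mxE mulr_suml.
Qed.

Lemma inner_invmx G (c : 'rV[R]_n) v : G \in unitmx ->
  inner G (c *m invmx G) v = \sum_l c 0 l * v 0 l.
Proof.
by move=> uG; rewrite /inner mulmxKV // mxE; apply: eq_bigr => l _; rewrite !mxE.
Qed.

Lemma posdef_unitmx G : (forall v, v != 0 -> 0 < inner G v v) -> G \in unitmx.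
Proof.
move=> pG; rewrite unitmxE unitfE; apply/det0P => -[v v0 vG].
by have := pG v v0; rewrite /inner vG mul0mx mxE ltxx.
Qed.

Lemma inner_block_mx (r : R) G (u v : 'rV[R]_(1 + n)) :
  inner (block_mx (1%:M : 'M[R]_1) 0 0 (r *: G)) u v =
  u 0 0 * v 0 0 + r * inner G (rsubmx u) (rsubmx v).
Proof.
rewrite -[in LHS](hsubmxK u) -[in LHS](hsubmxK v) /inner.
rewrite mul_row_block tr_row_mx mul_row_col !mulmx0 addr0 add0r mulmx1.
rewrite mxE -scalemxAr -scalemxAl [X in _ + X]mxE; congr (_ + _).
by rewrite mxE big_ord1 !mxE; congr (u _ _ * v _ _); apply/val_inj.
Qed.

End Inner.

Lemma leibniz3 {R : comRingType} (a g b a' g' b' : R) :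
  a * g * b' + b * (a * g' + g * a') = a' * g * b + a * g * b' + a * g' * b.
Proof. by ring. Qed.

Section DeriveInner.
Context {R : realType} {V : normedModType R} {n : nat}.

Lemma is_derive_inner (G : V -> 'M[R]_n) (a b : V -> 'rV[R]_n) (x v : V)
    (G' : 'M[R]_n) (a' b' : 'rV[R]_n) :
  (forall k l, is_derive x v (fun y => G y k l : R^o) (G' k l)) ->
  (forall k, is_derive x v (fun y => a y 0 k : R^o) (a' 0 k)) ->
  (forall k, is_derive x v (fun y => b y 0 k : R^o) (b' 0 k)) ->
  is_derive x v (fun y => inner (G y) (a y) (b y) : R^o)
    (inner (G x) a' (b x) + inner (G x) (a x) b' + inner G' (a x) (b x)).
Proof.
move=> dG da db.
pose F k l : V -> R^o :=
  (fun y => a y 0 k) * (fun y => G y k l) * (fun y => b y 0 l).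
have -> : (fun y => inner (G y) (a y) (b y) : R^o) = \sum_k \sum_l F k l.
  apply/funext => y; rewrite innerE fct_sumE; apply: eq_bigr => k _.
  by rewrite fct_sumE.
apply: is_derive_eq.
rewrite !innerE -!big_split; apply: eq_bigr => k _ /=.
rewrite -!big_split; apply: eq_bigr => l _ /=.
exact: leibniz3.
Qed.

Lemma differentiable_inner (G : V -> 'M[R]_n) (a b : V -> 'rV[R]_n) (x : V) :
  (forall k l, differentiable (fun y => G y k l : R^o) x) ->
  (forall k, differentiable (fun y => a y 0 k : R^o) x) ->
  (forall k, differentiable (fun y => b y 0 k : R^o) x) ->
  differentiable (fun y => inner (G y) (a y) (b y) : R^o) x.
Proof.
move=> dG da db; under eq_fun do rewrite innerE.
apply: differentiable_bigsum => k; apply: differentiable_bigsum => l.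
apply: (differentiableM (f := fun y => a y 0 k * G y k l)); last exact: db.
by apply: (differentiableM (f := fun y => a y 0 k)); [exact: da|exact: dG].
Qed.

End DeriveInner.

Lemma derive_sum_delta {R : realType} {n : nat} (k : 'rV[R]_n -> R^o)
    (y z : 'rV[R]_n) : differentiable k y ->
  'D_z k y = \sum_l z 0 l * 'D_(delta_mx 0 l) k y.
Proof.
move=> dk; rewrite (deriveE z dk) {1}(row_sum_delta z) linear_sum.
by apply: eq_bigr => l _; rewrite linearZ -(deriveE _ dk).
Qed.

Section ConsRow.
Context {R : realType} {n : nat}.

Definition row_cons (a : R) (b : 'rV[R]_n) : 'rV[R]_n.+1 :=
  row_mx (a%:M : 'M[R]_1) b.

Definition row_tail (y : 'rV[R]_n.+1) : 'rV[R]_n := rsubmx (y : 'rV[R]_(1 + n)).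

Lemma row_consK a b : row_tail (row_cons a b) = b.
Proof. exact: row_mxKr. Qed.

Lemma row_cons0 a b : row_cons a b 0 0 = a.
Proof.
rewrite /row_cons mxE; case: splitP => j // _.
by rewrite ord1 mxE.
Qed.

Lemma row_tailE y k : row_tail y 0 k = y 0 (lift 0 k).
Proof. by rewrite mxE; congr (y _ _); apply/val_inj. Qed.

Lemma row_consP (y z : 'rV[R]_n.+1) :
  y 0 0 = z 0 0 -> row_tail y = row_tail z -> y = z.
Proof.
move=> yz0 yzt; apply/rowP => j; have [k ->|->] := unliftP 0 j; last exact: yz0.
by rewrite -!row_tailE yzt.
Qed.

Lemma row_tail_linear : linear row_tail.
Proof. by move=> a u v; rewrite /row_tail linearP. Qed.

Lemma row_tailZ a y : row_tail (a *: y) = a *: row_tail y.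
Proof. exact: linearZ. Qed.

Lemma row_tailB y z : row_tail (y - z) = row_tail y - row_tail z.
Proof. exact: linearB. Qed.

Lemma row_tail0 : row_tail 0 = 0.
Proof. exact: linear0. Qed.

End ConsRow.

Section DeriveRow.
Context {R : realType} {V : normedModType R} {n : nat}.
Variables (a : V -> R^o) (b : V -> 'rV[R]_n) (x v : V).
Hypotheses (da : derivable a x v) (db : derivable b x v).

Lemma derivable_row_cons :
  derivable (fun y => row_cons (a y) (b y)) x v.
Proof.
apply/derivable_mxP => i j; rewrite ord1.
have [k ->|->] := unliftP 0 j; last by under eq_fun do rewrite row_cons0.
under eq_fun do rewrite -row_tailE row_consK.
exact: ((derivable_mxP _ _ _).1 db).
Qed.

Lemma derive_row_cons :
  'D_v (fun y => row_cons (a y) (b y)) x = row_cons ('D_v a x) ('D_v b x).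
Proof.
apply: row_consP.
  rewrite row_cons0 derive_mx; last exact: derivable_row_cons.
  by rewrite mxE; under eq_fun do rewrite row_cons0.
rewrite row_consK; apply/rowP => k; rewrite row_tailE.
rewrite derive_mx; last exact: derivable_row_cons.
rewrite mxE (derive_mx db) mxE.
by under eq_fun do rewrite -row_tailE row_consK.
Qed.

End DeriveRow.

(** Used for linear maps [L]; only their behaviour on the line through [y] with
    direction [d] matters for a directional derivative. *)
Lemma is_derive_additive_comp {R : realType} {V W : normedModType R}
    (L : V -> W) (k : W -> R^o) (y d : V) (l : R) :
  (forall (h : R), L (h *: d + y) = h *: L d + L y) ->
  is_derive (L y) (L d) k l -> is_derive y d (fun z => k (L z)) l.
Proof.
move=> hL [dk dl].
have E : (fun h : R => h^-1 *: (((fun z => k (L z)) \o shift y) (h *: d) - k (L y)))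
       = (fun h : R => h^-1 *: ((k \o shift (L y)) (h *: L d) - k (L y))).
  by apply/funext => h /=; rewrite hL.
by split; rewrite /derivable /derive E.
Qed.

Section DerivMetric.
Context {R : realType} {V : normedModType R} {n : nat}.
Variables (g : V -> 'M[R]_n) (x : V).
Hypothesis dg : forall k l, differentiable (fun y => g y k l : R^o) x.

(** The entries are differentiated, so the vectors paired by this form are kept
    constant in coordinates: it is not a covariant derivative. *)
Definition dmetric (u : V) : 'M[R]_n :=
  \matrix_(k, l) 'D_u (fun y => g y k l : R^o) x.

Lemma is_derive_dmetric (u : V) k l :
  is_derive x u (fun y => g y k l : R^o) (dmetric u k l).
Proof. by rewrite mxE; apply/derivableP/diff_derivable/dg. Qed.

Lemma is_derive_inner_cst (u : V) (a b : 'rV[R]_n) :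
  is_derive x u (fun y => inner (g y) a b : R^o) (inner (dmetric u) a b).
Proof.
have := is_derive_inner (is_derive_dmetric u) (a := cst a) (b := cst b)
  (a' := 0) (b' := 0).
rewrite /inner !mul0mx trmx0 mulmx0 mxE !add0r; apply => k;
  rewrite mxE; exact: is_derive_cst.
Qed.

Lemma derive_inner_cst (u : V) (a b : 'rV[R]_n) :
  'D_u (fun y => inner (g y) a b : R^o) x = inner (dmetric u) a b.
Proof. by have [] := is_derive_inner_cst u a b. Qed.

Lemma inner_dmetricZ (t : R) (u : V) (a b : 'rV[R]_n) :
  inner (dmetric (t *: u)) a b = t * inner (dmetric u) a b.
Proof.
rewrite -!derive_inner_cst derive_dirZ //.
by apply: (differentiable_inner (a := cst a) (b := cst b)) => // k;
  exact: differentiable_cst.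
Qed.

End DerivMetric.

(** The inverse Gram matrix in the definition of the symbols cancels against the
    inner product, and the coordinates of [z] recombine the coordinate
    derivatives, by linearity, into the derivative along [z]. *)
Lemma inner_christoffel {R : realType} {m : nat} (G : 'rV[R]_m -> 'M[R]_m)
    (y a b z : 'rV[R]_m) : G y \in unitmx ->
  (forall k l, differentiable (fun w => G w k l : R^o) y) ->
  inner (G y) (christoffel G y a b) z =
  2^-1 * (inner (dmetric G y a) b z + inner (dmetric G y b) a z
          - inner (dmetric G y z) a b).
Proof.
move=> uG dG; have D c d : inner (dmetric G y c) d z =
    \sum_l z 0 l * inner (dmetric G y c) d (delta_mx 0 l).
  rewrite {1}(row_sum_delta z); elim/big_rec2: _ => [|l s w _ <-].
    by rewrite /inner trmx0 mulmx0 mxE.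
  by rewrite innerDr innerZr.
have dab : differentiable (fun w => inner (G w) a b : R^o) y.
  by apply: (differentiable_inner (a := cst a) (b := cst b)) => // k;
    exact: differentiable_cst.
rewrite /christoffel inner_invmx // (D a) (D b) -(derive_inner_cst dG z).
rewrite (derive_sum_delta z dab) -big_split -sumrB mulr_sumr /=.
apply: eq_bigr => l _; rewrite mxE !(derive_inner_cst dG).
by rewrite mulrC mulrCA -mulrDr -mulrBr.
Qed.

(** * The gradient and its squared length in coordinates *)

Section Gradient.
Context {R : realType} {n : nat}.
Variables (O : set 'rV[R]_n) (g : 'rV[R]_n -> 'M[R]_n) (f : 'rV[R]_n -> R^o).

Definition coord_grad (x : 'rV[R]_n) : 'rV[R]_n :=
  (\row_k 'D_(delta_mx 0 k) f x) *m invmx (g x).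

Definition sqgrad (x : 'rV[R]_n) : R^o :=
  inner (g x) (coord_grad x) (coord_grad x).

Hypotheses (O_open : open O)
  (g_diff : forall k l y, O y -> differentiable (fun x => g x k l : R^o) y)
  (g_sym : forall y, O y -> (g y)^T = g y)
  (g_pos : forall y v, O y -> v != 0 -> 0 < inner (g y) v v)
  (f_smooth : smooth_on O f).

Let f_diff y : O y -> differentiable f y.
Proof. exact: (f_smooth [::]). Qed.

Let Df_diff (u y : 'rV[R]_n) : O y -> differentiable ('D_u f) y.
Proof. exact: (f_smooth [:: u]). Qed.

Let nearO y : O y -> \forall z \near y, O z.
Proof. by move=> Oy; apply: open_nbhs_nbhs. Qed.

Lemma inner_coord_grad y v : O y -> inner (g y) (coord_grad y) v = 'D_v f y.
Proof.
move=> Oy; rewrite inner_invmx; last first.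
  by apply: posdef_unitmx => w; exact: g_pos.
rewrite (derive_sum_delta v (f_diff Oy)); apply: eq_bigr => l _.
by rewrite mxE mulrC.
Qed.

Lemma differentiable_coord_grad y k : O y ->
  differentiable (fun x => coord_grad x 0 k : R^o) y.
Proof.
move=> Oy; under eq_fun do rewrite mxE.
apply: differentiable_bigsum => l.
apply: (differentiableM (f := fun x => (\row_k 'D_(delta_mx 0 k) f x) 0 l)).
  by under eq_fun do rewrite mxE; exact: Df_diff.
apply: differentiable_invmx => [i j|]; first exact: g_diff.
apply: filterS (nearO Oy) => z Oz.
by apply: posdef_unitmx => w; exact: g_pos.
Qed.

Lemma differentiable_sqgrad y : O y -> differentiable sqgrad y.
Proof.
move=> Oy; apply: differentiable_inner => [k l|k|k].
- exact: g_diff.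
- exact: differentiable_coord_grad.
- exact: differentiable_coord_grad.
Qed.

Definition dgrad (u y : 'rV[R]_n) : 'rV[R]_n :=
  \row_k 'D_u (fun x => coord_grad x 0 k : R^o) y.

Let is_derive_grad (u y : 'rV[R]_n) k : O y ->
  is_derive y u (fun x => coord_grad x 0 k : R^o) (dgrad u y 0 k).
Proof.
by move=> Oy; rewrite mxE; apply/derivableP/diff_derivable/differentiable_coord_grad.
Qed.

(** Obtained by differentiating the identity [inner_coord_grad] along [u]. *)
Lemma derive2E (u v y : 'rV[R]_n) : O y ->
  'D_u ('D_v f) y =
  inner (g y) (dgrad u y) v + inner (dmetric g y u) (coord_grad y) v.
Proof.
move=> Oy.
have [_ <-] : is_derive y u ('D_v f : 'rV[R]_n -> R^o)
   (inner (g y) (dgrad u y) v + inner (dmetric g y u) (coord_grad y) v) => //.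
apply: (@near_eq_is_derive _ _ _ (fun x => inner (g x) (coord_grad x) v : R^o)).
  by apply: filterS (nearO Oy) => z; exact: inner_coord_grad.
have D0 k : is_derive y u (fun x => (cst v : 'rV[R]_n -> 'rV[R]_n) x 0 k : R^o)
    ((0 : 'rV[R]_n) 0 k).
  by rewrite mxE; exact: is_derive_cst.
apply: is_derive_eq.
  apply: (is_derive_inner (is_derive_dmetric (fun k l => g_diff k l Oy) u) _ D0).
  by move=> k; exact: is_derive_grad.
by rewrite /inner trmx0 mulmx0 [X in _ + X + _]mxE addr0.
Qed.

(** The product rule gives [2 g(D_u w, w) + (D_u g)(w, w)]; [derive2E] with [v]
    the value of the gradient at [y] eliminates [D_u w]. *)
Lemma derive_sqgrad (u y : 'rV[R]_n) : O y ->
  'D_u sqgrad y = 2 * 'D_u ('D_(coord_grad y) f) y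
     - inner (dmetric g y u) (coord_grad y) (coord_grad y).
Proof.
move=> Oy; rewrite (derive2E u (coord_grad y) Oy).
have [_ ->] := is_derive_inner (is_derive_dmetric (fun k l => g_diff k l Oy) u)
  (fun k => is_derive_grad u k Oy) (fun k => is_derive_grad u k Oy).
rewrite (innerC (coord_grad y) _ (g_sym Oy)).
move: (inner _ _ _) (inner _ _ _) => a b; ring.
Qed.

Lemma derive2C (u v y : 'rV[R]_n) : O y -> 'D_u ('D_v f) y = 'D_v ('D_u f) y.
Proof.
move=> Oy; apply: schwarz.
- apply: filterS (nearO Oy) => z Oz.
  by split; [exact: f_diff|exact: Df_diff|exact: Df_diff].
- exact/differentiable_continuous/(f_smooth [:: u; v]).
- exact/differentiable_continuous/(f_smooth [:: v; u]).
Qed.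

End Gradient.

(** * The warped metric *)

Lemma inner_delta {R : realType} {m : nat} (G : 'M[R]_m) (k l : 'I_m) :
  inner G (delta_mx 0 k) (delta_mx 0 l) = G k l.
Proof. by rewrite /inner trmx_delta -rowE -colE !mxE. Qed.

Section WarpedMetric.
Context {R : realType} {n : nat}.
Variables (O : set 'rV[R]_n) (g : 'rV[R]_n -> 'M[R]_n) (rho : R^o -> R^o).
Hypotheses
  (g_diff : forall k l y, O y -> differentiable (fun x => g x k l : R^o) y)
  (g_pos : forall y v, O y -> v != 0 -> 0 < inner (g y) v v)
  (rho_diff : forall t, differentiable rho t) (rho_pos : forall t, 0 < rho t).

Definition warped_gram (y : 'rV[R]_n.+1) : 'M[R]_n.+1 :=
  block_mx (1%:M : 'M[R]_1) 0 0 (rho (y 0 0) ^+ 2 *: g (row_tail y)).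

Lemma inner_warped (y a b : 'rV[R]_n.+1) : inner (warped_gram y) a b =
  a 0 0 * b 0 0 + rho (y 0 0) ^+ 2 * inner (g (row_tail y)) (row_tail a) (row_tail b).
Proof. exact: inner_block_mx. Qed.

Lemma warped_posdef (y a : 'rV[R]_n.+1) : O (row_tail y) -> a != 0 ->
  0 < inner (warped_gram y) a a.
Proof.
move=> Oy a0; rewrite inner_warped -expr2.
have r0 : 0 < rho (y 0 0) ^+ 2 by rewrite exprn_gt0.
have [ta0|ta0] := eqVneq (row_tail a) 0.
  rewrite ta0 /inner trmx0 mulmx0 mxE mulr0 addr0 exprn_even_gt0 //=.
  by apply: contraNneq a0 => a00; apply/eqP/row_consP;
    rewrite ?a00 ?mxE // ta0 row_tail0.
by rewrite ltr_wpDl ?sqr_ge0 // mulr_gt0 // g_pos.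
Qed.

Let rho2_diff (y : 'rV[R]_n.+1) :
  differentiable (fun w : 'rV[R]_n.+1 => rho (w 0 0) ^+ 2 : R^o) y.
Proof.
apply: (@differentiableX _ _ (fun w : 'rV[R]_n.+1 => rho (w 0 0)) 1).
apply: (@differentiable_comp _ _ _ _ (fun w : 'rV[R]_n.+1 => w 0 0 : R^o) rho).
  exact: differentiable_coord.
exact: rho_diff.
Qed.

Let inner_tail_diff (y : 'rV[R]_n.+1) (a b : 'rV[R]_n) : O (row_tail y) ->
  differentiable (fun w => inner (g (row_tail w)) a b : R^o) y.
Proof.
move=> Oy.
apply: (@differentiable_comp _ _ _ _ row_tail (fun x => inner (g x) a b : R^o)).
  exact: (@differentiable_rsubmx _ 1 1 n y).
apply: (differentiable_inner (a := cst a) (b := cst b)) => [k l|k|k].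
- exact: g_diff.
- exact: differentiable_cst.
- exact: differentiable_cst.
Qed.

Lemma differentiable_warped (y : 'rV[R]_n.+1) k l : O (row_tail y) ->
  differentiable (fun w => warped_gram w k l : R^o) y.
Proof.
move=> Oy; under eq_fun do rewrite -inner_delta inner_warped.
apply: (differentiableD (f := cst _)); first exact: differentiable_cst.
exact: (differentiableM (rho2_diff y) (inner_tail_diff _ _ Oy)).
Qed.

Lemma inner_dmetric_warped (y d a b : 'rV[R]_n.+1) : O (row_tail y) ->
  inner (dmetric warped_gram y d) a b =
  'D_(d 0 0) (fun t : R^o => rho t ^+ 2 : R^o) (y 0 0)
     * inner (g (row_tail y)) (row_tail a) (row_tail b)
  + rho (y 0 0) ^+ 2
     * inner (dmetric g (row_tail y) (row_tail d)) (row_tail a) (row_tail b).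
Proof.
move=> Oy.
rewrite -(derive_inner_cst (fun k l => differentiable_warped k l Oy)).
under eq_fun do rewrite inner_warped.
have drho2 : is_derive y d (fun w : 'rV[R]_n.+1 => rho (w 0 0) ^+ 2 : R^o)
    ('D_(d 0 0) (fun t : R^o => rho t ^+ 2 : R^o) (y 0 0)).
  apply: (@is_derive_additive_comp _ _ R^o (fun w : 'rV[R]_n.+1 => w 0 0)
    (fun t => rho t ^+ 2)); first by move=> h; rewrite !mxE.
  apply/derivableP/diff_derivable.
  exact: (@differentiableX _ _ rho 1 _ (rho_diff _)).
have dg : is_derive y d
   (fun w => inner (g (row_tail w)) (row_tail a) (row_tail b) : R^o)
   (inner (dmetric g (row_tail y) (row_tail d)) (row_tail a) (row_tail b)).
  apply: (@is_derive_additive_comp _ _ _ row_tail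
    (fun x => inner (g x) (row_tail a) (row_tail b))).
    by move=> h; rewrite row_tail_linear.
  by apply: is_derive_inner_cst => k l; exact: g_diff.
have D := is_deriveD (is_derive_cst (a 0 0 * b 0 0 : R^o) y d)
  (is_deriveM drho2 dg).
have [_ ->] := D.
by rewrite add0r addrC; congr (_ + _); rewrite [LHS]mulrC.
Qed.

End WarpedMetric.

(** * The shape operator of a graph *)

Lemma shape_cancellation {R : realType} (r p k H A C S T1 T2 T3 : R) :
  S = r * (- p * (k * H) - k * (- p * A)) ->
  T1 = r * (k * (- p * A)) -> T2 = r * (- p * (k * A)) ->
  T3 = r * (k * (- p * C)) ->
  S + 2^-1 * (T1 + T2 - T3) = - (r * p * k) * (H - 2^-1 * C).
Proof. by move=> -> -> -> ->; field. Qed.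

Section GraphShape.
Context {R : realType} {n : nat}.
Variables (O : set 'rV[R]_n) (g : 'rV[R]_n -> 'M[R]_n) (f : 'rV[R]_n -> R^o)
  (rho : R^o -> R^o).
Hypotheses (O_open : open O)
  (g_diff : forall k l y, O y -> differentiable (fun x => g x k l : R^o) y)
  (g_pos : forall y v, O y -> v != 0 -> 0 < inner (g y) v v)
  (f_smooth : smooth_on O f)
  (rho_diff : forall t, differentiable rho t) (rho_pos : forall t, 0 < rho t).

Let f_diff y : O y -> differentiable f y.
Proof. exact: (f_smooth [::]). Qed.

Let Df_diff (u y : 'rV[R]_n) : O y -> differentiable ('D_u f) y.
Proof. exact: (f_smooth [:: u]). Qed.

Let G := warped_gram g rho.
Let w := coord_grad g f.

Section Normal.
Variables (phi : 'rV[R]_n -> R^o) (x : 'rV[R]_n).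
Hypotheses (Ox : O x) (phi_diff : differentiable phi x).

Let eta (y : 'rV[R]_n) : 'rV[R]_n := - phi y *: w y.

Let eta_derivable v : derivable eta x v.
Proof.
apply/derivable_mxP => i j; rewrite ord1 /eta.
under eq_fun do rewrite mxE.
apply/diff_derivable/(differentiableM (f := fun y => - phi y)).
  exact: differentiableN.
exact: (differentiable_coord_grad O_open g_diff g_pos f_smooth).
Qed.

Let is_derive_eta v k :
  is_derive x v (fun y => eta y 0 k : R^o) (('D_v eta x) 0 k).
Proof.
rewrite (derive_mx (@eta_derivable v)) mxE; apply: derivableP.
exact: ((derivable_mxP _ _ _).1 (@eta_derivable v)).
Qed.

(** Differentiate [g(eta, u) = - phi df(u)]: the derivative of [phi] comes with
    the factor [df(u)], which vanishes at [x]. *)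
Lemma inner_derive_eta (v u : 'rV[R]_n) : 'D_u f x = 0 ->
  inner (g x) ('D_v eta x) u =
  - phi x * 'D_v ('D_u f) x - inner (dmetric g x v) (eta x) u.
Proof.
move=> ux.
have D0 k : is_derive x v (fun y => (cst u : 'rV[R]_n -> 'rV[R]_n) y 0 k : R^o)
    ((0 : 'rV[R]_n) 0 k).
  by rewrite mxE; exact: is_derive_cst.
have [_ D1] := is_derive_inner
  (is_derive_dmetric (fun k l => g_diff k l Ox) v) (is_derive_eta v) D0.
have D2 : is_derive x v (fun y => - phi y * 'D_u f y : R^o)
    (- phi x *: 'D_v ('D_u f) x + 'D_u f x *: 'D_v (fun y => - phi y : R^o) x).
  apply: (is_deriveM (f := fun y => - phi y)).
    exact/derivableP/diff_derivable/differentiableN.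
  exact/derivableP/diff_derivable/Df_diff.
have E : 'D_v (fun y => inner (g y) (eta y) u : R^o) x =
         'D_v (fun y => - phi y * 'D_u f y : R^o) x.
  apply: near_eq_derive.
  have nO : \forall y \near x, O y by apply: open_nbhs_nbhs.
  apply: filterS nO => y Oy.
  by rewrite innerZl (inner_coord_grad g_pos f_smooth).
have [_ D2v] := D2.
move: D2v; rewrite -E D1 ux scale0r addr0.
have -> : inner (g x) (eta x) 0 = 0 by rewrite /inner trmx0 mulmx0 mxE.
by rewrite addr0 => D; apply: (addIr (inner (dmetric g x v) (eta x) u));
  rewrite addrNK; exact: D.
Qed.

(** In [inner_christoffel] the derivatives of the metric along [(df(v), v)] and
    along [Y x] give terms in the derivative of [rho^2] that carry the factor
    [g(w, u) = df(u) = 0], and the derivative of [rho^2] along [(0, u)]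
    is zero.  The remaining terms and that of [inner_derive_eta] combine because [v]
    and [eta x] are both multiples of [w x]. *)
Lemma inner_cov_deriv_normal (c Y : 'rV[R]_n -> 'rV[R]_n.+1)
    (v u : 'rV[R]_n) (k : R) :
  (\forall y \near x, c y = row_cons (f y) y) ->
  (\forall y \near x, Y y = row_cons (phi y * rho (f y) ^+ 2) (eta y)) ->
  v = k *: w x -> 'D_u f x = 0 ->
  inner (G (c x)) (cov_deriv G c Y x v) (row_cons 0 u) =
  - (rho (f x) ^+ 2 * phi x * k) *
    ('D_(w x) ('D_u f) x - 2^-1 * inner (dmetric g x u) (w x) (w x)).
Proof.
move=> nc nY vk ux.
have gwu : inner (g x) (w x) u = 0 by rewrite (inner_coord_grad g_pos f_smooth).
have cx : c x = row_cons (f x) x := nbhs_singleton nc.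
have Yx : Y x = row_cons (phi x * rho (f x) ^+ 2) (eta x) := nbhs_singleton nY.
have Dc : 'D_v c x = row_cons ('D_v f x) v.
  rewrite (near_eq_derive v nc) derive_row_cons ?derive_id //.
  exact/diff_derivable/f_diff.
have DY : exists a, 'D_v Y x = row_cons a ('D_v eta x).
  eexists; rewrite (near_eq_derive v nY) derive_row_cons //.
  apply/diff_derivable/(differentiableM (f := phi)) => //.
  apply: (@differentiableX _ _ (fun y => rho (f y)) 1).
  by apply: (@differentiable_comp _ _ _ _ f rho); [exact: f_diff|exact: rho_diff].
have [a {}DY] := DY.
have Ocx : O (row_tail (c x)) by rewrite cx row_consK.
have uG : G (c x) \in unitmx.
  by apply: posdef_unitmx => b; exact: (warped_posdef g_pos rho_pos).
have DZ t d b b' := inner_dmetricZ (fun k l => g_diff k l Ox) t d b b'.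
have DG d b b' : inner (dmetric G (c x) d) b b' =
    'D_(d 0 0) (fun t : R^o => rho t ^+ 2 : R^o) (f x)
      * inner (g x) (row_tail b) (row_tail b')
    + rho (f x) ^+ 2
      * inner (dmetric g x (row_tail d)) (row_tail b) (row_tail b').
  rewrite (inner_dmetric_warped g_diff rho_diff d b b' Ocx).
  by rewrite cx row_cons0 row_consK.
rewrite /cov_deriv innerDl (inner_christoffel _ _ _ uG); last first.
  by move=> i j; exact: (differentiable_warped g_diff rho_diff).
rewrite Dc DY Yx; apply: (@shape_cancellation _ _ _ _ _ (inner (dmetric g x (w x)) (w x) u)).
- rewrite inner_warped cx !row_consK !row_cons0 mulr0 add0r; congr (_ * _).
  rewrite (inner_derive_eta v ux) vk (derive_dirZ _ _ (Df_diff u Ox)) DZ.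
  by rewrite /eta innerZl.
- rewrite DG !row_consK row_cons0 /eta innerZl gwu mulr0 mulr0 add0r.
  by rewrite vk DZ innerZl.
- rewrite DG !row_consK row_cons0 /eta vk innerZl gwu mulr0 mulr0 add0r.
  by rewrite DZ innerZl.
- rewrite DG !row_consK row_cons0 derive0 mul0r add0r.
  by rewrite vk /eta innerZl innerZr.
Qed.

End Normal.
End GraphShape.

Lemma mulN_inj0 {R : realType} (r a b : R) : r != 0 ->
  0 = - r * (a - b) -> a = b.
Proof.
move=> r0 /esym/eqP; rewrite mulNr oppr_eq0 mulf_eq0 (negbTE r0) /=.
by rewrite subr_eq0 => /eqP.
Qed.

Section PrincipalDirection.
Context {R : realType} {n : nat}.
Variables (O : set 'rV[R]_n) (g : 'rV[R]_n -> 'M[R]_n) (f : 'rV[R]_n -> R^o)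
  (rho : R^o -> R^o).
Hypotheses (O_open : open O)
  (g_diff : forall k l y, O y -> differentiable (fun x => g x k l : R^o) y)
  (g_sym : forall y, O y -> (g y)^T = g y)
  (g_pos : forall y v, O y -> v != 0 -> 0 < inner (g y) v v)
  (f_smooth : smooth_on O f)
  (rho_diff : forall t, differentiable rho t) (rho_pos : forall t, 0 < rho t).

Let G := warped_gram g rho.
Let w := coord_grad g f.

Let normal (y : 'rV[R]_n) : 'rV[R]_n.+1 := row_cons (rho (f y) ^+ 2) (- w y).

(** The explicit form [phiE] below shows that the normalizing factor is
    differentiable. *)
Let phi (y : 'rV[R]_n) : R^o := (vnorm (G (row_cons (f y) y)) (normal y))^-1.

Lemma sqgrad_ge0 y : O y -> 0 <= sqgrad g f y.
Proof.
move=> Oy; rewrite /sqgrad; have [->|w0] := eqVneq (coord_grad g f y) 0.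
  by rewrite /inner trmx0 mulmx0 mxE.
by rewrite ltW // g_pos.
Qed.

Let phiE y : phi y =
  (Num.sqrt (rho (f y) ^+ 2 * (rho (f y) ^+ 2 + sqgrad g f y)))^-1.
Proof.
rewrite /phi /vnorm inner_warped !row_cons0 !row_consK innerNl innerNr opprK.
by rewrite -mulrDr.
Qed.

Let norm2_gt0 y : O y -> 0 < rho (f y) ^+ 2 * (rho (f y) ^+ 2 + sqgrad g f y).
Proof.
by move=> Oy; rewrite mulr_gt0 ?ltr_wpDr ?exprn_gt0 ?sqgrad_ge0.
Qed.

Let phi_gt0 y : O y -> 0 < phi y.
Proof. by move=> Oy; rewrite phiE invr_gt0 sqrtr_gt0 norm2_gt0. Qed.

Let phi_diff x : O x -> differentiable phi x.
Proof.
move=> Ox.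
have -> : phi = fun y => (Num.sqrt (rho (f y) ^+ 2 * (rho (f y) ^+ 2
     + sqgrad g f y)))^-1 by apply/funext => y; rewrite phiE.
have rf : differentiable (fun y => rho (f y) ^+ 2 : R^o) x.
  apply: (@differentiableX _ _ (fun y => rho (f y)) 1).
  apply: (@differentiable_comp _ _ _ _ f rho); last exact: rho_diff.
  exact: (f_smooth [::]).
have dn : differentiable (fun y => rho (f y) ^+ 2 * (rho (f y) ^+ 2
     + sqgrad g f y) : R^o) x.
  apply: (differentiableM rf); apply: (differentiableD rf).
  exact: (differentiable_sqgrad O_open g_diff g_pos f_smooth).
apply: (differentiableV (f := fun y => Num.sqrt (rho (f y) ^+ 2 * (rho (f y) ^+ 2
     + sqgrad g f y)))); last by rewrite gt_eqF // sqrtr_gt0 norm2_gt0.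
apply: (@differentiable_comp _ _ _ _ _ (Num.sqrt : R^o -> R^o) _ dn).
apply/derivable1_diffP.
by have [] := is_derive1_sqrt (norm2_gt0 Ox).
Qed.

(** The last components of [XT] read [v = k w] with [k > 0], which gives both
    claims: [w = 0] would make [XT] vanish, and for [df(u) = 0] the vector
    [(0, u)] is orthogonal to [XT], so that [inner_cov_deriv_normal] has zero
    left-hand side. *)
Lemma principal_direction_local (c Y : 'rV[R]_n -> 'rV[R]_n.+1)
    (x v : 'rV[R]_n) (lambda : R) (XT : 'rV[R]_n.+1) : O x ->
  (\forall y \near x, c y = row_cons (f y) y) ->
  (\forall y \near x, Y y = (vnorm (G (c y)) (normal y))^-1 *: normal y) ->
  XT = row_cons 1 0 - inner (G (c x)) (row_cons 1 0) (Y x) *: Y x ->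
  XT != 0 -> 'D_v c x = XT -> - cov_deriv G c Y x v = lambda *: XT ->
  w x != 0 /\ forall u, 'D_u f x = 0 -> 'D_u (sqgrad g f) x = 0.
Proof.
move=> Ox nc nY XTE XT0 DcXT shXT.
have cx : c x = row_cons (f x) x := nbhs_singleton nc.
have nY' : \forall y \near x,
    Y y = row_cons (phi y * rho (f y) ^+ 2) (- phi y *: w y).
  apply: filterS2 nc nY => y cy ->; rewrite cy -/(phi y).
  apply: row_consP; first by rewrite mxE !row_cons0.
  by rewrite row_tailZ !row_consK scalerN scaleNr.
have Yx := nbhs_singleton nY'.
have Dc : 'D_v c x = row_cons ('D_v f x) v.
  rewrite (near_eq_derive v nc) derive_row_cons ?derive_id //.
  exact/diff_derivable/(f_smooth [::]).
pose k := phi x * rho (f x) ^+ 2 * phi x.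
have k0 : k != 0 by rewrite gt_eqF // !mulr_gt0 // ?exprn_gt0 // phi_gt0.
have vk : v = k *: w x.
  have := congr1 row_tail DcXT; rewrite Dc row_consK => ->.
  rewrite XTE row_tailB row_tailZ row_consK sub0r Yx row_consK.
  rewrite inner_warped !row_cons0 row_consK mul1r /inner !mul0mx mxE mulr0 addr0.
  by rewrite scaleNr scalerN opprK scalerA.
split.
  apply: contraNneq XT0 => w0.
  by rewrite -DcXT vk w0 scaler0 derive0.
move=> u ux.
have gvu : inner (g x) v u = 0.
  by rewrite vk innerZl (inner_coord_grad g_pos f_smooth) // ux mulr0.
have := inner_cov_deriv_normal O_open g_diff g_pos f_smooth rho_diff rho_pos
  Ox (phi_diff Ox) nc nY' vk ux.
have -> : inner (warped_gram g rho (c x))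
    (cov_deriv (warped_gram g rho) c Y x v) (row_cons 0 u) = 0.
  rewrite -[cov_deriv _ _ _ _ _]opprK shXT innerNl innerZl -DcXT Dc.
  by rewrite inner_warped cx !row_cons0 !row_consK gvu !mulr0 addr0 mulr0 oppr0.
have r0 : rho (f x) ^+ 2 * phi x * k != 0.
  by rewrite !mulf_neq0 // gt_eqF // ?exprn_gt0 // phi_gt0.
move=> /(mulN_inj0 r0) H.
rewrite (derive_sqgrad O_open g_diff g_sym g_pos f_smooth) //.
rewrite (derive2C O_open f_smooth) // H.
by rewrite mulrA divff // mul1r subrr.
Qed.

End PrincipalDirection.

(** * From charts to the manifold *)

Section Manifold.
Context {R : realType} {n : nat}.
Variables (N : riemannian R n) (F : N -> R).
Implicit Types (i j : chart_idx N).
Hypotheses (hN : is_riemannian_manifold N) (F_smooth : smooth_function F).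

Let hM := riemannian_smooth_manifold hN.

Let coord_fun (i : chart_idx N) (x : 'rV[R]_n) : R^o := F (chart_inv i x).

Let sq (i : chart_idx N) : 'rV[R]_n -> R^o := sqgrad (gram i) (coord_fun i).

Lemma chart_invK i x : chart_img i x -> chart i (chart_inv i x) = x.
Proof. by move=> [p ip <-]; rewrite (chartK hM). Qed.

Let img_chart i p : chart_dom i p -> chart_img i (chart i p).
Proof. by move=> ip; exists p. Qed.

Let gram_diff i k l y : chart_img i y ->
  differentiable (fun x => gram i x k l : R^o) y.
Proof. exact: (@gram_smooth _ _ _ hN i k l [::] y). Qed.

Let gram_symE i y : chart_img i y -> (gram i y)^T = gram i y.
Proof. by move=> [p ip <-]; exact: (gram_sym hN). Qed.

Let gram_pos i y v : chart_img i y -> v != 0 -> 0 < inner (gram i y) v v.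
Proof. by move=> [p ip <-]; exact: (gram_posdef hN). Qed.

Let img_open i : open (chart_img (M := N) i) := @chart_img_open _ _ _ hM i.

Let near_img i x : chart_img i x -> \forall y \near x, chart_img i y.
Proof. by move=> ix; apply: open_nbhs_nbhs; split; [exact: img_open|exact: ix]. Qed.

Lemma vnorm_grad i p : vnorm (gram_at i p) (grad F i p) = Num.sqrt (sq i (chart i p)).
Proof. by []. Qed.

Lemma derive_transition i j p u : chart_dom i p -> chart_dom j p ->
  'D_u (coord_fun i) (chart i p) =
  'D_('D_u (transition i j) (chart i p)) (coord_fun j) (chart j p).
Proof.
move=> ip jp.
have pT : transition i j (chart i p) = chart j p.
  by rewrite /transition (chartK hM).
have dT : differentiable (transition i j) (chart i p).
  by apply: (transition_smooth hM (i := i) (j := j) [::]); exists p.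
have dF : differentiable (coord_fun j) (transition i j (chart i p)).
  by rewrite pT; exact: (F_smooth [::] (img_chart jp)).
have E : \forall x \near chart i p,
    (coord_fun j \o transition i j) x = coord_fun i x.
  have jnear : \forall x \near chart i p, chart_dom j (chart_inv i x).
    apply: (chart_inv_continuous hM (img_chart ip)).
    rewrite (chartK hM ip).
    by apply: open_nbhs_nbhs; split => //; exact: (chart_dom_open hM).
  by apply: filterS jnear => x jx; rewrite /= /coord_fun /transition (chartK hM).
rewrite -(near_eq_derive u E) (deriveE u (differentiable_comp dT dF)).
by rewrite (diff_comp dT dF) /= -(deriveE u dT) -(deriveE _ dF) pT.
Qed.

(** With [T] the derivative of the transition map, [T wi] and [wj] both represent
    the differential of [F] against vectors of the form [T u], so
    [g(T wi - wj, T wi - wj)] is the difference of the two sides.  Its sign gives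
    the inequality without inverting [T]; equality follows by exchanging the
    charts. *)
Lemma sqgrad_chart_le i j p : chart_dom i p -> chart_dom j p ->
  sq i (chart i p) <= sq j (chart j p).
Proof.
move=> ip jp; set x := chart i p; set y := chart j p.
pose wi := coord_grad (gram i) (coord_fun i) x.
pose wj := coord_grad (gram j) (coord_fun j) y.
pose Twi := 'D_wi (transition i j) x.
have Oy : chart_img j y by exact: img_chart.
have Tii : sq i x = inner (gram j y) Twi Twi := gram_transition hN wi wi ip jp.
have Tij : sq i x = inner (gram j y) wj Twi.
  rewrite /sq /sqgrad (inner_coord_grad (@gram_pos i) (F_smooth (i := i)) wi (img_chart ip)).
  rewrite (derive_transition wi ip jp).
  by rewrite /wj (inner_coord_grad (@gram_pos j) (F_smooth (i := j)) _ Oy).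
have : 0 <= inner (gram j y) (Twi - wj) (Twi - wj).
  have [->|d0] := eqVneq (Twi - wj) 0; last by rewrite ltW // gram_pos.
  by rewrite /inner trmx0 mulmx0 mxE.
rewrite innerDl !innerDr !innerNl !innerNr opprK -Tii -Tij.
rewrite (innerC Twi wj (gram_symE Oy)) -Tij -[inner (gram j y) wj wj]/(sq j y).
move: (sq i x) (sq j y) => a b.
by rewrite subrr add0r addrC subr_ge0.
Qed.

Lemma vnorm_grad_chart i j p : chart_dom i p -> chart_dom j p ->
  vnorm (gram_at i p) (grad F i p) = vnorm (gram_at j p) (grad F j p).
Proof.
by move=> ip jp; rewrite !vnorm_grad; congr Num.sqrt; apply: le_anti;
  rewrite !sqgrad_chart_le.
Qed.

Lemma transnormal_onP (U : set N) :
  (forall i j p q, U p -> U q -> chart_dom i p -> chart_dom j q -> F p = F q ->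
     vnorm (gram_at i p) (grad F i p) = vnorm (gram_at j q) (grad F j q)) <->
  transnormal_on U F.
Proof.
split=> [H|[b [_ bE]] i j p q Up Uq ip jq pq]; last by rewrite !bE // pq.
suff /choice[b Hb] : forall s : R, exists b : R, 0 <= b /\
    forall i p, U p -> chart_dom i p -> F p = s ->
      vnorm (gram_at i p) (grad F i p) = b.
  exists b; split=> [s|i p Up ip]; first by case: (Hb s).
  by have [_] := Hb (F p); apply.
move=> s; have [[i [p [Up ip ps]]]|nU] :=
    pselect (exists i p, [/\ U p, chart_dom i p & F p = s]).
  exists (vnorm (gram_at i p) (grad F i p)); split; first exact: sqrtr_ge0.
  by move=> j q Uq jq qs; apply: H => //; rewrite qs.
by exists 0; split => // i p Up ip ps; case: nU; exists i, p.
Qed.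

(** On the level set [A] of [p], the points where the gradient has the same length
    as at [p] form a set [B] that is open in [A], being the trace of the union of
    the transnormal open sets that meet [B], and closed in [A], since the same
    construction applies to its complement in [A]. *)
Lemma locally_transnormal_connected :
  (forall p, exists U : set N, [/\ open U, U p & transnormal_on U F]) ->
  (forall c : R, connected (F @^-1` [set c])) -> transnormal F.
Proof.
move=> loc conn; apply/transnormal_onP => i j p q _ _ ip jq pq.
pose A := F @^-1` [set F p].
pose B := A `&` [set z | forall k, chart_dom k z ->
   vnorm (gram_at k z) (grad F k z) = vnorm (gram_at i p) (grad F i p)].
pose fam (D : set N) := [set U : set N | [/\ open U, transnormal_on U F & U `&` D !=set0]].
have Bin (U : set N) z z' : transnormal_on U F -> U z -> U z' -> B z -> A z' -> B z'.
  move=> /transnormal_onP TU Uz Uz' [Az Bz] Az'; split=> // k kz'.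
  have [l lz] := chart_cover hM z.
  by rewrite -(Bz l lz); apply: TU => //; rewrite Az Az'.
suff BA : B = A.
  by have [_ /(_ j jq) ->] : B q by rewrite BA /A /= pq.
apply: conn.
- exists p; split; first exact: erefl.
  by move=> k kp; exact: vnorm_grad_chart.
- exists (\bigcup_(U in fam B) U); first by apply: bigcup_open => U [].
  apply/seteqP; split=> [z Bz|z [Az [U [_ TU [z' [Uz' Bz']]] Uz]]].
    split; first by case: Bz.
    have [U [oU Uz TU]] := loc z.
    by exists U => //; split => //; exists z.
  exact: (Bin U z' z).
- exists (~` \bigcup_(U in fam (A `\` B)) U).
    by apply: open_closedC; apply: bigcup_open => U [].
  apply/seteqP; split=> [z Bz|z [Az nz]].
    split; first by case: Bz.
    by move=> [U [_ TU [z' [Uz' [Az' nBz']]]] Uz]; apply: nBz'; exact: (Bin U z).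
  apply: contrapT => nBz; apply: nz; have [U [oU Uz TU]] := loc z.
  by exists U => //; split => //; exists z.
Qed.

Section Graph.
Variable rho : R^o -> R^o.
Hypotheses (rho_diff : forall t, differentiable rho t)
  (rho_pos : forall t, 0 < rho t)
  (F_cpd : canonical_principal_direction
     (graph rho F) (graph_unit_normal rho F) (partial_t N rho)).

Lemma graph_principal_direction i x : chart_img i x ->
  coord_grad (gram i) (coord_fun i) x != 0 /\
  forall u, 'D_u (coord_fun i) x = 0 -> 'D_u (sq i) x = 0.
Proof.
move=> Ox; have [q iq qx] := Ox.
have [XT0 [v [lambda [push sh]]]] := F_cpd (i := i) (j := i) (p := q) iq iq.
have qK : chart_inv i x = q by rewrite -qx (chartK hM).
have nO := near_img Ox.
pose c := local_map (graph rho F) i i.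
pose Y y := graph_unit_normal rho F i (chart_inv i y).
have nc : \forall y \near x, c y = row_cons (coord_fun i y) y.
  by apply: filterS nO => y Oy; rewrite /c /local_map /= (chart_invK Oy).
have nY : \forall y \near x,
    Y y = (vnorm (warped_gram (gram i) rho (c y))
             (row_cons (rho (coord_fun i y) ^+ 2)
                       (- coord_grad (gram i) (coord_fun i) y)))^-1 *:
          row_cons (rho (coord_fun i y) ^+ 2)
                   (- coord_grad (gram i) (coord_fun i) y).
  apply: filterS nO => y Oy.
  have gE : grad F i (chart_inv i y) = coord_grad (gram i) (coord_fun i) y.
    by rewrite -[in RHS](chart_invK Oy).
  by rewrite -gE.
have XTE : tangent_part (graph rho F) (graph_unit_normal rho F)
    (partial_t N rho) i q = row_cons 1 0
    - inner (warped_gram (gram i) rho (c x)) (row_cons 1 0) (Y x) *: Y x.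
  by rewrite /c /Y /local_map qK.
rewrite /Defs.pushforward /Defs.shape qx in push sh.
exact: (principal_direction_local (@img_open i) (@gram_diff i) (@gram_symE i)
  (@gram_pos i) (F_smooth (i := i)) rho_diff rho_pos Ox nc nY XTE XT0 push sh).
Qed.

(** The gradient itself serves as the direction in which [F] is increasing. *)
Lemma graph_locally_transnormal p :
  exists U : set N, [/\ open U, U p & transnormal_on U F].
Proof.
have [i ip] := chart_cover hM p.
set x := chart i p; have Ox : chart_img i x by exact: img_chart.
have nO := near_img Ox.
pose e := coord_grad (gram i) (coord_fun i) x.
have [|||d d0 dE] := @constant_on_level_sets R _ (coord_fun i) (sq i) e x.
- apply: filterS nO => y Oy; split.
  + exact: (F_smooth [::] Oy).
  + exact: (differentiable_sqgrad (@img_open i) (@gram_diff i) (@gram_pos i)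
      (F_smooth (i := i))).
  + by have [] := graph_principal_direction Oy.
- rewrite -(inner_coord_grad (@gram_pos i) (F_smooth (i := i)) e Ox).
  by apply: gram_pos => //; have [] := graph_principal_direction Ox.
- exact/differentiable_continuous/(F_smooth [:: e] Ox).
exists (chart_dom i `&` chart i @^-1` ball x d); split.
- rewrite openE => z [iz bz]; apply: filterI.
    by apply: open_nbhs_nbhs; split => //; exact: (chart_dom_open hM).
  apply: (chart_continuous hM iz).
  by apply: open_nbhs_nbhs; split => //; exact: ball_open.
- by split => //; exact: ballxx.
apply/transnormal_onP => j k q q' [iq bq] [iq' bq'] jq kq' qq'.
rewrite (vnorm_grad_chart jq iq) (vnorm_grad_chart kq' iq') !vnorm_grad.
congr Num.sqrt; apply: dE => //.
by rewrite /coord_fun !(chartK hM).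
Qed.

End Graph.
End Manifold.

Theorem proposition8 (R : realType) (n : nat)
    (N : riemannian R n) (hN : is_riemannian_manifold N)
    (rho : R -> R)
    (rho_smooth : smooth_on (setT : set R^o) (rho : R^o -> R^o))
    (rho_pos : forall t : R, 0 < rho t)
    (F : N -> R) (F_smooth : smooth_function F)
    (theta : N -> R)
    (theta_range : forall p : N, 0 < theta p < pi)
    (theta_angle : forall (i : chart_idx (warped_product N rho)) (p : N),
       chart_dom i (graph rho F p) ->
       cos (theta p) = inner (gram_at i (graph rho F p))
                         (graph_unit_normal rho F i p)
                         (partial_t N rho i (graph rho F p)))
    (theta_neq : forall p : N, theta p != pi / 2)
    (F_cpd : canonical_principal_direction
       (graph rho F) (graph_unit_normal rho F) (partial_t N rho)) :
  (forall p : N, exists U : set N, [/\ open U, U p & transnormal_on U F]) /\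
  ((forall c : R, connected (F @^-1` [set c])) -> transnormal F).
Proof.
have rho_diff t : differentiable (rho : R^o -> R^o) t := rho_smooth [::] t I.
have loc := graph_locally_transnormal hN F_smooth rho_diff rho_pos F_cpd.
by split=> //; exact: locally_transnormal_connected.
Qed.
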